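(* Let $\gamma\in(1,2]$ and $\mathbf U=(D,\mathbf m,E)^\top\in\mathcal G$. Let $\{p_n\}_{n\ge 0}$ be the sequence generated by the NR-I method $$p_{n+1}=p_n-\frac{\phi(p_n)}{\phi'(p_n)},\qquad p_0=\begin{cases}0,& \text{if } c_2>0,\\ \dfrac{-3c_3+\sqrt{9c_3^2-24c_2}}{12},&\text{otherwise.}\end{cases}$$ Then $\{p_n\}_{n\ge0}$ converges monotonically to the physical pressure $p(\mathbf U)$. Furthermore, the method is PCP, i.e. $p_n>0$ for all $n\ge1$.
   Context: Let $d\ge 1$, $\gamma\in(1,2]$, and $\mathcal G=\{(D,\mathbf m,E)^\top: D\in\mathbb R,\ \mathbf m\in\mathbb R^d,\ E\in\mathbb R,\ D>0,\ E-\sqrt{D^2+|\mathbf m|^2}>0\}$. For $\mathbf U\in\mathcal G$ there is a unique triple $(\rho,\mathbf v,p)$ with $\rho>0$, $p>0$, $|\mathbf v|<1$ such that $D=\rho W$, $\mathbf m=DhW\mathbf v$, $E=DhW-p$, where $W=1/\sqrt{1-|\mathbf v|^2}$, $h=1+e+p/\rho$, $e=\frac{p}{(\gamma-1)\rho}$. The physical pressure $p(\mathbf U)$ is the component $p$ of this triple; it is the unique positive solution of $$\Phi(p):=\frac{p}{\gamma-1}-E+\frac{|\mathbf m|^2}{E+p}+D\sqrt{1-\frac{|\mathbf m|^2}{(E+p)^2}}=0 .$$ The quartic polynomial $\phi$ is $$\phi(p)=(\gamma-1)^2\Big[\big(|\mathbf m|^2+(E+p)(\tfrac{p}{\gamma-1}-E)\big)^2-D^2\big((E+p)^2-|\mathbf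 m|^2\big)\Big]=c_0+c_1p+c_2p^2+c_3p^3+p^4,$$ with $c_0=(|\mathbf m|^2-E^2)(|\mathbf m|^2-E^2+D^2)(\gamma-1)^2$, $c_1=2E(2-\gamma)(|\mathbf m|^2-E^2)(\gamma-1)-2ED^2(\gamma-1)^2$, $c_2=E^2(\gamma^2-6\gamma+6)+2|\mathbf m|^2(\gamma-1)-D^2(\gamma-1)^2$, $c_3=2E(2-\gamma)$. A pressure-recovering iteration is called PCP (physical-constraint-preserving) if all iterates $p_n$, $n\ge1$, are positive. *)

(* Defs.v *)
From mathcomp Require Import all_boot all_order all_algebra.
From mathcomp Require Import all_classical all_reals all_analysis.
From mathcomp Require Import ring.

Set Implicit Arguments.
Unset Strict Implicit.
Unset Printing Implicit Defensive.

Import Order.TTheory GRing.Theory Num.Theory.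
Import numFieldNormedType.Exports.

Local Open Scope classical_set_scope.
Local Open Scope ring_scope.

(* The norm that MathComp-Analysis puts on 'rV[R]_d is the sup norm, so the
   Euclidean norm is defined here. *)
Definition l2norm (R : realType) (d : nat) (x : 'rV[R]_d) : R :=
  Num.sqrt (\sum_(i < d) x 0 i ^+ 2).

Record conserved (R : realType) (d : nat) : Type := Conserved {
  density : R;
  momentum : 'rV[R]_d;
  energy : R }.

Definition admissible (R : realType) (d : nat) : set (conserved R d) :=
  [set U | 0 < density U /\
    0 < energy U - Num.sqrt (density U ^+ 2 + l2norm (momentum U) ^+ 2)].

Definition lorentz (R : realType) (d : nat) (v : 'rV[R]_d) : R :=
  1 / Num.sqrt (1 - l2norm v ^+ 2).

Definition internal_energy (R : realType) (gamma rho p : R) : R :=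
  p / ((gamma - 1) * rho).

Definition enthalpy (R : realType) (gamma rho p : R) : R :=
  1 + internal_energy gamma rho p + p / rho.

Definition is_primitive (R : realType) (d : nat) (gamma : R)
    (U : conserved R d) (rho : R) (v : 'rV[R]_d) (p : R) : Prop :=
  let W := lorentz v in
  let h := enthalpy gamma rho p in
  [/\ 0 < rho, 0 < p & l2norm v < 1] /\
  [/\ density U = rho * W,
      momentum U = (density U * h * W) *: v
    & energy U = density U * h * W - p].

(* The value 0 is returned only if U has no primitive variables, which does
   not happen for 1 < gamma <= 2 and admissible U. *)
Definition pressure (R : realType) (d : nat) (gamma : R)
    (U : conserved R d) : R :=
  xget 0 [set p | exists (rho : R) (v : 'rV[R]_d), is_primitive gamma U rho v p].

Section Quartic.
Variables (R : realType) (d : nat) (gamma : R) (U : conserved R d).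
Let D := density U.
Let E := energy U.
Let m := l2norm (momentum U).

Definition phi : {poly R} :=
  (gamma - 1) ^+ 2 *:
    (((m ^+ 2)%:P + (E%:P + 'X) * ((gamma - 1)^-1 *: 'X - E%:P)) ^+ 2
     - D ^+ 2 *: ((E%:P + 'X) ^+ 2 - (m ^+ 2)%:P)).

Definition coef0 : R :=
  (m ^+ 2 - E ^+ 2) * (m ^+ 2 - E ^+ 2 + D ^+ 2) * (gamma - 1) ^+ 2.

Definition coef1 : R :=
  2 * E * (2 - gamma) * (m ^+ 2 - E ^+ 2) * (gamma - 1)
  - 2 * E * D ^+ 2 * (gamma - 1) ^+ 2.

Definition coef2 : R :=
  E ^+ 2 * (gamma ^+ 2 - 6 * gamma + 6) + 2 * m ^+ 2 * (gamma - 1)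
  - D ^+ 2 * (gamma - 1) ^+ 2.

Definition coef3 : R := 2 * E * (2 - gamma).

Lemma phi_expand : gamma != 1 ->
  phi = coef0%:P + coef1 *: 'X + coef2 *: 'X^2 + coef3 *: 'X^3 + 'X^4.
Proof.
move=> g1; have g0 : gamma - 1 != 0 by rewrite subr_eq0.
rewrite /phi /coef0 /coef1 /coef2 /coef3.
have VK : (gamma - 1)%:P * ((gamma - 1)^-1)%:P = 1 :> {poly R}.
  by rewrite -polyCM divff.
rewrite -!mul_polyC.
set w := ((gamma - 1)^-1)%:P in VK *.
rewrite !(polyCM, polyCD, polyCN, polyCB, polyC_exp, polyC1) in VK *.
set g := gamma%:P in VK *.
pose a : {poly R} := (m%:P ^+ 2 + (E%:P + 'X) * (w * 'X - E%:P)).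
have aE : (g - 1) * a
    = (g - 1) * m%:P ^+ 2 + (E%:P + 'X) * ('X - (g - 1) * E%:P).
  transitivity ((g - 1) * m%:P ^+ 2
      + (E%:P + 'X) * ((g - 1) * w * 'X - (g - 1) * E%:P)).
    by rewrite /a; ring.
  by rewrite VK mul1r.
rewrite -/a; transitivity (((g - 1) * a) ^+ 2
    - (g - 1) ^+ 2 * (D%:P ^+ 2 * ((E%:P + 'X) ^+ 2 - m%:P ^+ 2))).
  by ring.
by rewrite aE; ring.
Qed.

Definition nr1_init : R :=
  if 0 < coef2 then 0
  else (- 3 * coef3 + Num.sqrt (9 * coef3 ^+ 2 - 24 * coef2)) / 12.

End Quartic.

Definition PCP (R : realType) (p : nat -> R) : Prop :=
  forall n, (1 <= n)%N -> 0 < p n.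

(* Main.v *)
(* Write phi = (gamma - 1)^2 (A^2 - D^2 B) with A(x) = |m|^2 + (E + x)(x /
   (gamma - 1) - E) and B(x) = (E + x)^2 - |m|^2.  Since gamma <= 2, A is
   nondecreasing on x >= 0.  The physical pressure r is a positive root of phi
   with A(r) < 0, and phi' < 0 wherever A <= 0, in particular on [0, r].  The
   starting point is 0 if phi is already convex on x >= 0, and otherwise the
   nonnegative inflection point p_0, so phi is convex on [p_0, +oo) and, if
   p_0 > 0, concave on [0, p_0].  If p_0 <= r, Newton's method increases to r
   inside the convex zone; if p_0 > r, then phi' <= phi'(r) < 0 on [r, p_0] by
   concavity, and Newton's method decreases to r inside the concave zone. *)
Require Import Defs.
From mathcomp Require Import all_boot all_order all_algebra.
From mathcomp Require Import all_classical all_reals all_analysis.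
From mathcomp Require Import ring lra.
Import Order.TTheory GRing.Theory Num.Theory.
Import numFieldNormedType.Exports.
Local Open Scope classical_set_scope.
Local Open Scope ring_scope.

(** * Newton's method inside a zone of convexity or concavity *)

Lemma newton_convex_nondecreasing (R : realType) (f df : R -> R) (a r : R)
    (p : nat -> R) :
  continuous f -> continuous df -> f r = 0 ->
  (forall x, a <= x <= r -> df x < 0) ->
  (forall x y, a <= x <= r -> a <= y <= r -> f x + df x * (y - x) <= f y) ->
  a <= p 0%N <= r ->
  (forall n, p n.+1 = p n - f (p n) / df (p n)) ->
  [/\ forall n, a <= p n <= r, nondecreasing_seq p & p @ \oo --> r].
Proof.
move=> cf cdf fr df0 convex p0 pS.
(* The tangent at [r] gives [0 <= f x], so the step moves right; the tangent at [x], whose value at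
   [r] is at most [f r = 0], keeps the step from passing [r]. *)
have step x : a <= x <= r -> x <= x - f x / df x <= r.
  move=> ax; have dx := df0 _ ax; have /andP[a_x x_r] := ax.
  have rr : a <= r <= r by rewrite lexx (le_trans a_x).
  have f_ge0 : 0 <= f x.
    have := convex r x rr ax; have := df0 _ rr; rewrite fr add0r => dr.
    by apply: le_trans; rewrite mulr_le0 ?(ltW dr) ?subr_le0.
  apply/andP; split.
    by rewrite lerDl oppr_ge0 mulr_ge0_le0 // invr_le0 ltW.
  have := convex x r ax rr; rewrite fr => h.
  rewrite lerBlDl -lerBlDr -subr_ge0 opprB addrA.
  have -> : f x / df x + r - x = (f x + df x * (r - x)) / df x.
    by field; rewrite lt_eqF.
  by rewrite mulr_le0 // invr_le0 ltW.
have inv n : a <= p n <= r.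
  elim: n => [//|n IHn]; rewrite pS; have /andP[h ->] := step _ IHn.
  by rewrite andbT (le_trans _ h) //; case/andP: IHn.
have p_mono : nondecreasing_seq p.
  by apply/nondecreasing_seqP => n; rewrite pS; have /andP[] := step _ (inv n).
split=> //.
have /cvg_ex[l pl] : cvgn p.
  apply: nondecreasing_is_cvgn => //.
  by exists r => _ [n _ <-]; have /andP[] := inv n.
have al : a <= l by apply: (cvgr_to_ge pl); near=> n; have /andP[] := inv n.
have lr : l <= r by apply: (cvgr_to_le pl); near=> n; have /andP[] := inv n.
(* Multiplying the recursion by [df (p n)] writes [f (p n)] as a product tending to
   [(l - l) * df l]. The tangent at [r] then excludes a zero [l < r]. *)
have fl : f l = 0.
  have pSl : (fun n => p n.+1) @ \oo --> l by rewrite (cvg_shiftS p).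
  have h1 : (fun n => f (p n)) @ \oo --> f l.
    exact: (continuous_cvg _ (cf l) pl).
  have h2 : (fun n => (p n - p n.+1) * df (p n)) @ \oo --> (l - l) * df l.
    by apply: cvgM; [exact: cvgB|exact: (continuous_cvg _ (cdf l) pl)].
  have e : (fun n => (p n - p n.+1) * df (p n)) = (fun n => f (p n)).
    apply/funext => n; rewrite pS opprB addrC subrK divfK //.
    by rewrite lt_eqF // df0.
  rewrite e in h2.
  by rewrite (cvg_unique _ h1 h2) // subrr mul0r.
have rr : a <= r <= r by rewrite lexx (le_trans al).
have := convex r l rr; rewrite al lr fl fr add0r => /(_ isT).
have := df0 _ rr => dr; rewrite nmulr_rle0 // subr_ge0 => rl.
by rewrite (_ : r = l) //; apply/le_anti; rewrite rl lr.
Unshelve. all: by end_near.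
Qed.

(** Passing to [- f (- x)] turns concavity into convexity, keeps the slope negative, and sends
    Newton iterates to their opposites. *)
Lemma newton_concave_nonincreasing (R : realType) (f df : R -> R) (r b : R)
    (p : nat -> R) :
  continuous f -> continuous df -> f r = 0 ->
  (forall x, r <= x <= b -> df x < 0) ->
  (forall x y, r <= x <= b -> r <= y <= b -> f y <= f x + df x * (y - x)) ->
  r <= p 0%N <= b ->
  (forall n, p n.+1 = p n - f (p n) / df (p n)) ->
  [/\ forall n, r <= p n <= b, nonincreasing_seq p & p @ \oo --> r].
Proof.
move=> cf cdf fr df0 concave p0 pS.
have flip (c d x : R) : (- d <= x <= - c) = (c <= - x <= d).
  by rewrite lerNl lerNr andbC.
have [|||||||pb pm pl] := @newton_convex_nondecreasing R (fun x => - f (- x))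
    (fun x => df (- x)) (- b) (- r) (fun n => - p n).
- by move=> x; apply: cvgN; apply: continuous_comp; [exact: opp_continuous|exact: cf].
- by move=> x; apply: continuous_comp; [exact: opp_continuous|exact: cdf].
- by rewrite opprK fr oppr0.
- by move=> x; rewrite flip => /df0.
- move=> x y; rewrite !flip => hx hy.
  by have := concave _ _ hx hy; rewrite -lerN2; apply: le_trans; lra.
- by rewrite flip opprK.
- by move=> n; rewrite pS !opprK mulNr opprB addrC opprK.
split.
- by move=> n; have := pb n; rewrite flip opprK.
- by move=> i j /pm; rewrite lerN2.
- by rewrite -[p]opprK -[r]opprK; exact: cvgN pl.
Qed.

(** * The Euclidean norm *)

Section l2norm_theory.
Variables (R : realType) (d : nat).
Implicit Types (x : 'rV[R]_d) (k : R).

Lemma l2norm_ge0 x : 0 <= l2norm x.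
Proof. exact: sqrtr_ge0. Qed.

Lemma l2normZ k x : 0 <= k -> l2norm (k *: x) = k * l2norm x.
Proof.
move=> k0; rewrite /l2norm -[in RHS](ger0_norm k0) -sqrtr_sqr -sqrtrM ?sqr_ge0//.
by rewrite mulr_sumr; under eq_bigr do rewrite mxE exprMn.
Qed.

End l2norm_theory.

(** * The functions [pA] and [pB], and the sign of the derivative of [phi] *)

Section pressure_equation.
Variables (R : realType) (d : nat) (gamma : R) (U : conserved R d).
Hypothesis gammaP : 1 < gamma <= 2.
Hypothesis admU : admissible U.
Implicit Types (x y p r rho : R).
Local Notation D := (density U).
Local Notation E := (energy U).
Local Notation m := (l2norm (momentum U)).
Local Notation q := (phi gamma U).

(* [pA x + D * Num.sqrt (pB x)] is [(E + x) * Phi(x)], and [phi] is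
   [(gamma - 1) ^ 2] times the product of this factor with its conjugate. *)
Definition pA x : R := m ^+ 2 + (E + x) * (x / (gamma - 1) - E).
Definition pB x : R := (E + x) ^+ 2 - m ^+ 2.

Lemma gammaB1_gt0 : 0 < gamma - 1.
Proof. by rewrite subr_gt0; case/andP: gammaP. Qed.

Lemma density_gt0 : 0 < D. Proof. by have [] := admU. Qed.

Lemma energy_gt0 : 0 < E.
Proof.
have [_ h] := admU; rewrite subr_gt0 in h.
exact: le_lt_trans (sqrtr_ge0 _) h.
Qed.

Lemma density_momentum_lt_energy : D ^+ 2 + m ^+ 2 < E ^+ 2.
Proof.
have [_ h] := admU; rewrite subr_gt0 in h.
have s0 : 0 <= D ^+ 2 + m ^+ 2 by rewrite addr_ge0 ?sqr_ge0.
by rewrite -(sqr_sqrtr s0) ltr_pXn2r // nnegrE ?sqrtr_ge0 // ltW // energy_gt0.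
Qed.

Lemma horner_phi x :
  q.[x] = (gamma - 1) ^+ 2 * (pA x ^+ 2 - D ^+ 2 * pB x).
Proof. by rewrite /phi /pA /pB !hornerE [x / _]mulrC. Qed.

Lemma horner_phi_coef x : q.[x] = Defs.coef0 gamma U + Defs.coef1 gamma U * x
  + Defs.coef2 gamma U * x ^+ 2 + Defs.coef3 gamma U * x ^+ 3 + x ^+ 4.
Proof.
by rewrite phi_expand ?hornerE // ?gt_eqF //; case/andP: gammaP.
Qed.

Lemma horner_dphi_coef x : q^`().[x] = Defs.coef1 gamma U
  + 2 * Defs.coef2 gamma U * x + 3 * Defs.coef3 gamma U * x ^+ 2 + 4 * x ^+ 3.
Proof.
rewrite phi_expand ?gt_eqF //; last by case/andP: gammaP.
move: (Defs.coef0 _ _) (Defs.coef1 _ _) (Defs.coef2 _ _) (Defs.coef3 _ _) => a b c e.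
by rewrite !poly.derivE !hornerE /=; ring.
Qed.

Lemma horner_dphi x : q^`().[x] = (gamma - 1) ^+ 2 *
  (2 * pA x * ((E + 2 * x) / (gamma - 1) - E) - 2 * D ^+ 2 * (E + x)).
Proof.
rewrite horner_dphi_coef /Defs.coef1 /Defs.coef2 /Defs.coef3 /pA.
by field; rewrite gt_eqF // gammaB1_gt0.
Qed.

(** At [x + y] this expression is the difference quotient of [pA] between [x] and [y]; at [2 * x] it
    is the derivative of [pA] at [x]. Its sign comes from [gamma - 1 <= 1]. *)
Lemma pA_slope_ge0 x : 0 <= x -> 0 <= (E + x) / (gamma - 1) - E.
Proof.
move=> x0; have E0 := energy_gt0; have g0 := gammaB1_gt0.
rewrite subr_ge0 ler_pdivlMr //.
have g1 : gamma - 1 <= 1 by case/andP: gammaP => _; lra.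
by apply: (@le_trans _ _ E); [rewrite ler_piMr // ltW|lra].
Qed.

Lemma pA_homo x y : 0 <= x -> x <= y -> pA x <= pA y.
Proof.
move=> x0 xy; rewrite -subr_ge0.
have -> : pA y - pA x = (y - x) * ((E + (x + y)) / (gamma - 1) - E).
  by rewrite /pA; field; rewrite gt_eqF // gammaB1_gt0.
by rewrite mulr_ge0 ?subr_ge0 // -subr_ge0 pA_slope_ge0 //; lra.
Qed.

(** Up to the factor [(gamma - 1) ^+ 2], the derivative is [2 pA pA' - D^2 pB'], with [pA' >= 0] and
    [pB' > 0]. *)
Lemma dphi_lt0 x : 0 <= x -> pA x <= 0 -> q^`().[x] < 0.
Proof.
move=> x0 Ax; rewrite horner_dphi pmulr_rlt0 ?exprn_gt0 ?gammaB1_gt0 //.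
have D0 : 0 < D ^+ 2 by rewrite exprn_gt0 // density_gt0.
have E0 := energy_gt0.
rewrite subr_lt0; apply: (@le_lt_trans _ _ 0).
  rewrite mulr_le0_ge0 //; first by rewrite mulr_ge0_le0.
  by apply: pA_slope_ge0; lra.
by rewrite mulr_gt0 ?(mulr_gt0 _ D0) // ltr_pwDl.
Qed.

Lemma pB_gt0 x : 0 <= x -> 0 < pB x.
Proof.
move=> x0; rewrite subr_gt0; apply: (@lt_le_trans _ _ (E ^+ 2)).
  have := density_momentum_lt_energy; have := sqr_ge0 D; lra.
by rewrite ler_pXn2r ?nnegrE //; have := energy_gt0; lra.
Qed.

(** * The physical pressure as a root of [phi] *)

Lemma phi_rootE x : q.[x] = 0 <-> pA x ^+ 2 = D ^+ 2 * pB x.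
Proof.
rewrite horner_phi; split=> [/eqP|->]; last by rewrite subrr mulr0.
by rewrite mulf_eq0 subr_eq0 expf_eq0 gt_eqF ?gammaB1_gt0 // => /eqP.
Qed.

(** The value is [coef0], and admissibility makes both [m^2 - E^2] and [m^2 - E^2 + D^2]
    negative. *)
Lemma phi0_gt0 : 0 < q.[0].
Proof.
rewrite horner_phi_coef !(mulr0, expr0n, addr0) /=.
rewrite mulr_gt0 ?exprn_gt0 ?gammaB1_gt0 // nmulr_rgt0.
  by have := density_momentum_lt_energy; lra.
by have := density_momentum_lt_energy; have := sqr_ge0 D; nra.
Qed.

(** The sign of [pA p] selects the roots of [pA + D * sqrt pB], that is of Phi, against those of the
    conjugate factor. *)
Definition is_root_pressure p := [/\ 0 < p, q.[p] = 0 & pA p < 0].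

(** [phi] is positive at 0 and negative at a zero [x] of [pA], so it vanishes in between. There [pA]
    is at most [pA x = 0] by monotonicity, and equality would force [pB] to vanish. *)
Lemma root_pressure_exists : exists p, is_root_pressure p.
Proof.
have E0 := energy_gt0; have g0 := gammaB1_gt0; have D0 := density_gt0.
pose a : {poly R} := (m ^+ 2)%:P + (E%:P + 'X) * ((gamma - 1)^-1 *: 'X - E%:P).
have aE x : a.[x] = pA x by rewrite /a /pA !hornerE [x / _]mulrC.
have b0 : 0 <= (gamma - 1) * E by rewrite mulr_ge0 // ltW.
(* The right end cancels the factor [x / (gamma - 1) - E] of [pA], leaving [m ^+ 2]. *)
have [|x /andP[x0 _]] := @poly_ivt R a 0 ((gamma - 1) * E) b0.
  rewrite !aE /pA mul0r; apply/andP; split.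
    by have := density_momentum_lt_energy; have := sqr_ge0 D; nra.
  rewrite [_ * E]mulrC mulfK ?gt_eqF // subrr mulr0 addr0; exact: sqr_ge0.
rewrite rootE aE => /eqP Ax.
have qx : q.[x] < 0.
  rewrite horner_phi Ax expr0n /= sub0r mulrN oppr_lt0.
  by rewrite !mulr_gt0 ?exprn_gt0 ?pB_gt0.
have [|p /andP[p0 px]] := @poly_ivt R (- q) 0 x x0.
  by rewrite !hornerN oppr_le0 oppr_ge0 !ltW // phi0_gt0.
rewrite rootN rootE => /eqP qp; exists p; split=> //.
  rewrite lt_neqAle p0 andbT; apply/eqP => e.
  by move: phi0_gt0; rewrite [in q.[_]]e qp ltxx.
rewrite lt_neqAle -[X in _ <= X]Ax pA_homo // andbT; apply/eqP => Ap.
move/phi_rootE: qp; rewrite Ap expr0n /= => /esym/eqP.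
by rewrite gt_eqF // mulr_gt0 ?exprn_gt0 ?pB_gt0.
Qed.

(** With [s = 1 / W] and [K = E + p = D h W], the relation [|m| = K |v|] gives [pB p = (K s)^2], and
    the enthalpy law gives [pA p = - D K s]. *)
Lemma primitive_is_root rho v p :
  is_primitive gamma U rho v p -> is_root_pressure p.
Proof.
move=> [[rho0 p0 v1] [eD em eE]].
have g0 := gammaB1_gt0.
have D0 := density_gt0.
have w0 : 0 < 1 - l2norm v ^+ 2.
  by rewrite subr_gt0 expr_lt1 ?l2norm_ge0.
set s : R := Num.sqrt (1 - l2norm v ^+ 2).
have s0 : 0 < s by rewrite sqrtr_gt0.
have s2 : s ^+ 2 = 1 - l2norm v ^+ 2 by rewrite sqr_sqrtr ?ltW.
rewrite /lorentz -/s in eD em eE.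
pose K := D * enthalpy gamma rho p * (1 / s).
have eK : E + p = K by rewrite eE /K; lra.
have h0 : 0 < enthalpy gamma rho p.
  by rewrite /enthalpy /internal_energy !addr_gt0 ?divr_gt0 ?mulr_gt0.
have K0 : 0 < K by rewrite /K !mulr_gt0 ?invr_gt0.
have eB : pB p = (K * s) ^+ 2.
  by rewrite /pB eK em -/K l2normZ ?ltW // !exprMn s2; ring.
have eA : pA p = - (D * (K * s)).
  have e1 : pA p = (E + p) * p * (1 + (gamma - 1)^-1) - pB p.
    by rewrite /pA /pB; ring.
  rewrite e1 eB eK.
  (* This is [K = D h W] with [h] expanded and [D / rho = 1 / s]. *)
  have eh : K = D / s + p * (1 + (gamma - 1)^-1) / s ^+ 2.
    rewrite /K {1}eD /enthalpy /internal_energy eD; field.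
    by rewrite !gt_eqF.
  have -> : K * p * (1 + (gamma - 1)^-1) - (K * s) ^+ 2 =
     K * (p * (1 + (gamma - 1)^-1) - s ^+ 2 * K) by ring.
  rewrite {2}eh; field; by rewrite !gt_eqF.
split=> //.
  by apply/phi_rootE; rewrite eA eB sqrrN exprMn.
by rewrite eA oppr_lt0 mulr_gt0 ?(mulr_gt0 K0).
Qed.

(** The relations to invert force [v = m / (E + p)], hence [W = (E + p) / sqrt (pB p)], and
    [rho = D / W]. *)
Lemma root_is_primitive p : is_root_pressure p ->
  exists rho v, is_primitive gamma U rho v p.
Proof.
move=> [p0 /phi_rootE qp Ap].
have g0 := gammaB1_gt0; have D0 := density_gt0; have E0 := energy_gt0.
have B0 := pB_gt0 _ (ltW p0).
set b := Num.sqrt (pB p).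
have b0 : 0 < b by rewrite sqrtr_gt0.
have b2 : b ^+ 2 = pB p by rewrite sqr_sqrtr ?ltW.
have Ep : 0 < E + p by lra.
(* Of the two conjugate factors, [pA p - D * b] is negative, so the other one vanishes. *)
have eA : pA p = - (D * b).
  apply/eqP; have : (pA p - D * b) * (pA p + D * b) == 0.
    by rewrite -subr_sqr qp exprMn b2 subrr.
  rewrite mulf_eq0 => /orP[|]; last by rewrite addr_eq0.
  by rewrite lt_eqF // subr_lt0 (lt_trans Ap) // mulr_gt0.
pose v := (E + p)^-1 *: momentum U.
have nv : l2norm v = (E + p)^-1 * m by rewrite l2normZ // invr_ge0 ltW.
have ev : 1 - l2norm v ^+ 2 = (b / (E + p)) ^+ 2.
  by rewrite nv expr_div_n b2 /pB; field; rewrite gt_eqF.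
have W : lorentz v = (E + p) / b.
  rewrite /lorentz ev sqrtr_sqr ger0_norm; last by rewrite divr_ge0 ?ltW.
  by field; rewrite !gt_eqF.
have eh : D * enthalpy gamma (D * b / (E + p)) p * lorentz v = E + p.
  have e : D * b + (E + p) * p * (1 + (gamma - 1)^-1) = b ^+ 2.
    by rewrite b2 -[D * b]opprK -eA /pA /pB; ring.
  rewrite W /enthalpy /internal_energy.
  transitivity ((D * b + (E + p) * p * (1 + (gamma - 1)^-1)) * (E + p) / b ^+ 2).
    by field; rewrite !gt_eqF.
  by rewrite e; field; rewrite gt_eqF.
exists (D * b / (E + p)), v; split.
  split=> //; first by rewrite divr_gt0 ?mulr_gt0.
  rewrite -(@expr_lt1 _ 2) ?l2norm_ge0 // -subr_gt0 ev.
  by rewrite exprn_gt0 ?divr_gt0.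
rewrite /= eh; split.
- by rewrite W; field; rewrite !gt_eqF.
- by rewrite /v scalerA divff ?gt_eqF // scale1r.
- by rewrite addrK.
Qed.

(** Every value that [xget] can pick from the set is a root pressure; its default 0 would require an
    empty set, which the existence of a root excludes. *)
Lemma pressure_is_root : is_root_pressure (pressure gamma U).
Proof.
have [r hr] := root_pressure_exists.
rewrite /pressure; case: xgetP => [p _ [rho [v /primitive_is_root //]]|h].
by have [rho [v hv]] := root_is_primitive _ hr; case: (h r); exists rho, v.
Qed.

(** * Convexity and concavity of [phi] on either side of the starting point *)

Local Notation c2 := (Defs.coef2 gamma U).
Local Notation c3 := (Defs.coef3 gamma U).
Local Notation p0 := (nr1_init gamma U).

Lemma coef3_ge0 : 0 <= c3.
Proof.
by rewrite /Defs.coef3 !mulr_ge0 // ?(ltW energy_gt0) // subr_ge0; case/andP: gammaP.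
Qed.

Lemma nr1_init_ge0 : 0 <= p0.
Proof.
rewrite /nr1_init; case: ltP => // c2_le0.
rewrite divr_ge0 // mulNr addrC subr_ge0.
have h : 0 <= 3 * c3 by rewrite mulr_ge0 ?coef3_ge0.
by rewrite -(ger0_norm h) -sqrtr_sqr ler_wsqrtr // exprMn; lra.
Qed.

(** The left-hand side is half the second derivative of [phi] at [p0], and [p0] is the larger root
    of that quadratic. *)
Lemma nr1_init_inflection : c2 <= 0 -> c2 + 3 * c3 * p0 + 6 * p0 ^+ 2 = 0.
Proof.
move=> c2_le0; rewrite /nr1_init ltNge c2_le0 /=.
set r := Num.sqrt _.
have r2 : r ^+ 2 = 9 * c3 ^+ 2 - 24 * c2.
  by rewrite sqr_sqrtr //; have := sqr_ge0 c3; lra.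
have -> : c2 = (9 * c3 ^+ 2 - r ^+ 2) / 24 by rewrite r2; field.
by field.
Qed.

Lemma half_ddphi_ge0 : 0 <= c2 + 3 * c3 * p0 + 6 * p0 ^+ 2.
Proof.
have [c2_gt0|/nr1_init_inflection -> //] := ltP 0 c2.
by rewrite /nr1_init c2_gt0 expr0n !mulr0 !addr0 ltW.
Qed.

(** For [x = y] the second factor is half the second derivative of [phi]. It is nondecreasing in [x]
    and in [y] on the nonnegative reals, so comparison with its value at [x = y = p0] decides its
    sign. *)
Lemma phi_tangent x y : q.[y] - (q.[x] + q^`().[x] * (y - x)) =
  (y - x) ^+ 2 * (c2 + c3 * (2 * x + y) + (3 * x ^+ 2 + 2 * x * y + y ^+ 2)).
Proof. by rewrite !horner_phi_coef horner_dphi_coef; ring. Qed.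

Lemma phi_convex x y : p0 <= x -> p0 <= y ->
  q.[x] + q^`().[x] * (y - x) <= q.[y].
Proof.
move=> hx hy; rewrite -subr_ge0 phi_tangent mulr_ge0 ?sqr_ge0 //.
have s0 := nr1_init_ge0; have c30 := coef3_ge0.
apply: le_trans half_ddphi_ge0 _.
(* The three products add up to the increase of the second factor from [(p0, p0)] to [(x, y)]. *)
have : 0 <= c3 * (2 * (x - p0) + (y - p0)) by rewrite mulr_ge0; lra.
have : 0 <= (x - p0) * (3 * (x + p0) + 2 * y) by rewrite mulr_ge0; lra.
have : 0 <= (y - p0) * (3 * p0 + y) by rewrite mulr_ge0; lra.
by lra.
Qed.

Lemma phi_concave x y : c2 <= 0 -> 0 <= x <= p0 -> 0 <= y <= p0 ->
  q.[y] <= q.[x] + q^`().[x] * (y - x).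
Proof.
move=> c2_le0 /andP[x0 hx] /andP[y0 hy].
rewrite -subr_le0 phi_tangent mulr_ge0_le0 ?sqr_ge0 //.
have s0 := nr1_init_ge0; have c30 := coef3_ge0.
rewrite -(nr1_init_inflection c2_le0).
have : 0 <= c3 * (2 * (p0 - x) + (p0 - y)) by rewrite mulr_ge0; lra.
have : 0 <= (p0 - x) * (3 * (x + p0) + 2 * y) by rewrite mulr_ge0; lra.
have : 0 <= (p0 - y) * (3 * p0 + y) by rewrite mulr_ge0; lra.
by lra.
Qed.

(** The difference of the derivatives is [y - x] times a factor that increases with [x] and [y] and
    equals the second derivative of [phi], namely 0, at [x = y = p0]. *)
Lemma dphi_nonincreasing x y : c2 <= 0 -> 0 <= x -> x <= y -> y <= p0 ->
  q^`().[y] <= q^`().[x].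
Proof.
move=> c2_le0 x0 xy hy; rewrite -subr_le0 !horner_dphi_coef.
have -> : Defs.coef1 gamma U + 2 * c2 * y + 3 * c3 * y ^+ 2 + 4 * y ^+ 3 -
  (Defs.coef1 gamma U + 2 * c2 * x + 3 * c3 * x ^+ 2 + 4 * x ^+ 3) =
  (y - x) * (2 * c2 + 3 * c3 * (x + y) + 4 * (x ^+ 2 + x * y + y ^+ 2)) by ring.
rewrite mulr_ge0_le0 ?subr_ge0 //.
have s0 := nr1_init_ge0; have c30 := coef3_ge0.
have := nr1_init_inflection c2_le0.
have : 0 <= c3 * ((p0 - x) + (p0 - y)) by rewrite mulr_ge0; lra.
have : 0 <= (p0 - x) * (x + p0 + y) by rewrite mulr_ge0; lra.
have : 0 <= (p0 - y) * (2 * p0 + y) by rewrite mulr_ge0; lra.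
by lra.
Qed.

(** * The two regimes of the NR-I iteration *)

Variable p : nat -> R.
Hypothesis p_init : p 0%N = p0.
Hypothesis pS : forall n, p n.+1 = p n - q.[p n] / q^`().[p n].
Local Notation r := (pressure gamma U).

Lemma nr1_from_below : p0 <= r ->
  [/\ forall n, q^`().[p n] != 0, nondecreasing_seq p,
      p @ \oo --> r & PCP p].
Proof.
move=> p0r; have [r0 qr Ar] := pressure_is_root; have s0 := nr1_init_ge0.
have dq x : p0 <= x <= r -> q^`().[x] < 0.
  move=> /andP[hx xr]; have x0 := le_trans s0 hx.
  by apply: dphi_lt0 => //; apply: le_trans (ltW Ar); exact: pA_homo.
have [|||||pb pm pl] := @newton_convex_nondecreasing R (horner q)
    (horner q^`()) p0 r p (@continuous_horner _ _) (@continuous_horner _ _).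
- exact: qr.
- exact: dq.
- by move=> x y /andP[hx _] /andP[hy _]; exact: phi_convex.
- by rewrite p_init lexx.
- exact: pS.
split=> // [n|[//|n] _]; first by rewrite lt_eqF // dq.
apply: (@lt_le_trans _ _ (p 1%N)); last exact: pm.
(* If the start is 0, positivity begins at [p 1], which is [- phi(0) / phi'(0) > 0]. *)
have := s0; rewrite le_eqVlt => /orP[/eqP e|s_gt0].
  rewrite pS p_init -e sub0r oppr_gt0 pmulr_rlt0 ?phi0_gt0 // invr_lt0.
  by apply: dq; rewrite -e lexx ltW.
by apply: lt_le_trans s_gt0 _; rewrite -p_init; exact: pm.
Qed.

Lemma nr1_from_above : r <= p0 ->
  [/\ forall n, q^`().[p n] != 0, nonincreasing_seq p,
      p @ \oo --> r & PCP p].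
Proof.
move=> rp0; have [r0 qr Ar] := pressure_is_root.
have c2_le0 : c2 <= 0.
  rewrite leNgt; apply/negP => c2_gt0; move: rp0.
  by rewrite /nr1_init c2_gt0 leNgt r0.
(* Beyond [r] the sign of [pA] is unknown, so the negative slope is obtained at [r] and carried
   right by concavity. *)
have dq x : r <= x <= p0 -> q^`().[x] < 0.
  move=> /andP[rx hx]; apply: (@le_lt_trans _ _ q^`().[r]).
    by apply: dphi_nonincreasing => //; exact: ltW.
  by apply: dphi_lt0; exact: ltW.
have [|||||pb pm pl] := @newton_concave_nonincreasing R (horner q)
    (horner q^`()) r p0 p (@continuous_horner _ _) (@continuous_horner _ _).
- exact: qr.
- exact: dq.
- move=> x y /andP[hx ?] /andP[hy ?].
  by apply: phi_concave => //; apply/andP; split=> //; lra.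
- by rewrite p_init lexx andbT.
- exact: pS.
split=> // [n|n _]; first by rewrite lt_eqF // dq.
by have /andP[h _] := pb n; exact: lt_le_trans h.
Qed.

End pressure_equation.

Theorem theorem2p5 (R : realType) (d : nat) (gamma : R) (U : conserved R d)
    (p : nat -> R) :
  (1 <= d)%N -> 1 < gamma <= 2 -> admissible U ->
  p 0%N = nr1_init gamma U ->
  (forall n, p n.+1 = p n - (phi gamma U).[p n] / (phi gamma U)^`().[p n]) ->
  [/\ forall n, (phi gamma U)^`().[p n] != 0,
      nondecreasing_seq p \/ nonincreasing_seq p,
      p @ \oo --> pressure gamma U
    & PCP p].
Proof.
move=> _ gammaP admU p_init pS.
have [h|/ltW h] := leP (nr1_init gamma U) (pressure gamma U).
  by have [? ? ? ?] := nr1_from_below _ _ _ _ gammaP admU _ p_init pS h;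
    split=> //; left.
by have [? ? ? ?] := nr1_from_above _ _ _ _ gammaP admU _ p_init pS h;
  split=> //; right.
Qed.
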